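(* Let $T$ be a labelled tree on $n$ vertices and let $A\in M_n(\mathbb{R})$ be $T$-positive with $\det A>0$. Let $\sigma=(\sigma_1,\dots,\sigma_n)$ be signed according to $T$ and $S_\sigma=\operatorname{diag}(\sigma_1,\dots,\sigma_n)$. Then every entry of $S_\sigma A^{-1}S_\sigma$ is positive. Therefore $A$ satisfies the Neumaier conclusion: $A$ has a real eigenvalue $\lambda$ which is its unique eigenvalue of smallest absolute value (every complex eigenvalue $\mu\ne\lambda$ of $A$ satisfies $|\mu|>|\lambda|$), and $A$ has an eigenvector $x\in\mathbb{R}^n$ for $\lambda$ that is signed according to $T$, i.e. $\sigma_i x_i>0$ for all $i=1,\dots,n$.
   Context: A labelled tree $T$ on $n$ vertices has vertex set $\{1,\dots,n\}$. A pendent vertex is a vertex of degree 1. A real square matrix is totally positive (TP) if all its minors are positive, and is a P-matrix if all its principal minors are positive. For an ordered index list $\alpha$ of distinct elements of $\{1,\dots,n\}$, $A[\alpha]$ is the principal submatrix of $A$ with rows and columns indexed by $\alpha$, arranged in the order given by $\alpha$. For a path $\mathscr{P}$ in $T$, $A[\mathscr{P}]$ means $A[\alpha]$ where $\alpha$ lists the vertices of $\mathscr{P}$ in the order in which they appear along $\mathscr{P}$ (the direction is immaterial). $A(p)$ is the $(n-1)\times(n-1)$ submatrix of $A$ obtained by deleting row $p$ and column $p$. $A\in M_n(\mathbb{R})$ is T-TP if $A[\mathscr{P}]$ is TP for each path $\mathscr{P}$ of $T$ connecting two pendent vertices. $A$ is pendent-$P$ relative to $T$ if all principal submatrices associated with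 the deletion of pendent vertices (i.e. $A(p)$ for $p$ a pendent vertex of $T$) are P-matrices. $A$ is $T$-positive if it is both T-TP and pendent-$P$ relative to $T$. A vector $\sigma\in\{1,-1\}^n$ is signed according to $T$ if $\sigma_i=-\sigma_j$ whenever $i$ and $j$ are adjacent in $T$; such $\sigma$ is unique up to multiplication by $\pm1$. *)

(* Defs.v *)
From HB Require Import structures.
From mathcomp Require Import all_boot all_order all_algebra.
From mathcomp Require Import complex reals.

Set Implicit Arguments.
Unset Strict Implicit.
Unset Printing Implicit Defensive.

Import Order.TTheory GRing.Theory Num.Theory.
Local Open Scope ring_scope.

(* A graph on 'I_n is its adjacency relation. *)
Definition is_tree (n : nat) (e : rel 'I_n) : Prop :=
  [/\ (0 < n)%N, symmetric e, irreflexive e,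
      forall x y : 'I_n, connect e x y
    & forall c : seq 'I_n, (2 < size c)%N -> ~ ucycle e c].

Definition pendent (n : nat) (e : rel 'I_n) (v : 'I_n) : bool :=
  #|[set w | e v w]| == 1%N.

(* s lists, in order, the vertices of a path between two distinct pendent
   vertices. *)
Definition pendent_path (n : nat) (e : rel 'I_n) (s : seq 'I_n) : Prop :=
  exists (x : 'I_n) (p : seq 'I_n),
    [/\ s = x :: p, path e x p, uniq (x :: p)
      & [/\ pendent e x, pendent e (last x p) & x != last x p]].

(* A[s], with rows and columns in the order given by s. *)
Definition princ_submx (R : Type) (n : nat) (A : 'M[R]_n) (s : seq 'I_n) :
    'M[R]_(size s) :=
  mxsub (tnth (in_tuple s)) (tnth (in_tuple s)) A.

(* Minors are indexed by strictly increasing row and column selections; k = 0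
   only adds the empty minor 1. *)
Definition totally_positive (R : realType) (m : nat) (A : 'M[R]_m) : Prop :=
  forall (k : nat) (f g : 'I_k -> 'I_m),
    {homo f : i j / (i < j)%N} -> {homo g : i j / (i < j)%N} ->
    0 < \det (mxsub f g A).

Definition P_matrix (R : realType) (m : nat) (A : 'M[R]_m) : Prop :=
  forall (k : nat) (f : 'I_k -> 'I_m),
    {homo f : i j / (i < j)%N} -> 0 < \det (mxsub f f A).

Definition T_TP (R : realType) (n : nat) (e : rel 'I_n) (A : 'M[R]_n) : Prop :=
  forall s : seq 'I_n, pendent_path e s -> totally_positive (princ_submx A s).

Definition pendent_P (R : realType) (n : nat) (e : rel 'I_n) (A : 'M[R]_n) :
    Prop :=
  forall p : 'I_n, pendent e p -> P_matrix (row' p (col' p A)).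

Definition T_positive (R : realType) (n : nat) (e : rel 'I_n) (A : 'M[R]_n) :
    Prop :=
  T_TP e A /\ pendent_P e A.

Definition signed_according (R : realType) (n : nat) (e : rel 'I_n)
    (sigma : 'rV[R]_n) : Prop :=
  (forall i : 'I_n, sigma 0 i = 1 \/ sigma 0 i = -1) /\
  (forall i j : 'I_n, e i j -> sigma 0 i = - sigma 0 j).

Definition is_eigenvector (R : realType) (n : nat) (A : 'M[R]_n) (lambda : R)
    (x : 'cV[R]_n) : Prop :=
  x != 0 /\ A *m x = lambda *: x.

(* The complex eigenvalues of A are those of A seen as a matrix over R[i]; the
   norm of R[i] takes its values in the real elements of R[i].  The library's
   eigenvalue is defined by row vectors, which gives the same spectrum. *)
Definition neumaier (R : realType) (n : nat) (A : 'M[R]_n)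
    (sigma : 'rV[R]_n) : Prop :=
  exists lambda : R,
    [/\ eigenvalue A lambda,
        forall mu : R[i], eigenvalue (map_mx (real_complex R) A) mu ->
          mu != lambda%:C%C -> `|lambda%:C%C| < `|mu|
      & exists x : 'cV[R]_n, is_eigenvector A lambda x /\
          forall i : 'I_n, 0 < sigma 0 i * x i 0].

(* Main.v *)
Require Import Defs.
From HB Require Import structures.
From mathcomp Require Import all_boot all_order all_algebra.
From mathcomp Require Import complex reals.
From mathcomp Require Import polyrcf.
From mathcomp Require Import ring lra.

Set Implicit Arguments.
Unset Strict Implicit.
Unset Printing Implicit Defensive.

Import Order.TTheory GRing.Theory Num.Theory.
Local Open Scope ring_scope.

(** Everything rests on the sign pattern of B = A^-1: the matrix S B S, with
S = diag(sigma), is entrywise positive.  It is proved by induction on the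
number of vertices ([signed_inverse_positive]).

Deleting a pendent vertex p leaves a tree and keeps all the hypotheses
([del_pendent_tree], [T_positive_del]): a path of the smaller tree whose end is
the neighbour of p is completed by p to a path between pendent vertices of the
larger one; and A(p), being a P-matrix, has a positive determinant and principal
submatrices that are again P-matrices.  By induction the signed inverse of A(p)
is positive, and this inverse is the Schur complement of B(p,p) in B
([invmx_del]).  With b = S B S, this says b(i,p) b(p,j) < b(i,j) b(p,p) for
every pendent p and all i, j distinct from p.  If there are three pendent
vertices, these inequalities alone force every b(i,j) to be positive
([three_pivots_positive]).  A tree without three pendent vertices is a path
([tree_three_pendent_or_path]); if it has at least two vertices, then A is
totally positive in the order of the path, and the inverse of a totally positive
matrix has checkerboard signs ([totally_positive_invmx]).

The eigenvalue statement is the theorem of Perron for the positive matrix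
M = S A^-1 S.  Let rho be the infimum of the t for which some positive w
satisfies M w < t w.  For t > rho the system (t - M) x = y >= 0 has only
nonnegative solutions ([minimum_principle]); by continuity of the adjugate, an
invertible rho - M would produce such a w for t = rho, and then for a smaller t.
So rho is an eigenvalue, and the absolute values of an eigenvector form a
positive eigenvector ([perron_vector]).  Pairing that vector with the moduli of
a complex row eigenvector shows that every other eigenvalue is smaller in
modulus ([perron_dominant]).  The eigenvalues of A are the inverses of those of
M, so 1/rho is the eigenvalue of A of smallest modulus, with eigenvector S x. *)

(** * Trees and their pendent vertices *)

Lemma pendentP n (e : rel 'I_n) (p : 'I_n) :
  reflect (exists2 q, e p q & forall w, e p w -> w = q) (pendent e p).
Proof.
apply: (iffP cards1P) => [[q Nq]|[q epq uq]]; exists q.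
- by have := set11 q; rewrite -Nq inE.
- by move=> w epw; apply/set1P; rewrite -Nq inE.
- by apply/setP=> w; rewrite !inE; apply/idP/eqP=> [/uq|->].
Qed.

(** Any other edge from x back to the path would close a cycle with it. *)
Lemma tree_chord n (e : rel 'I_n) (x y z : 'I_n) (s : seq 'I_n) :
  is_tree e -> path e x (y :: s) -> uniq (x :: y :: s) -> e x z ->
  z \in y :: s -> z = y.
Proof.
case=> _ esym _ _ acyc pth un exz; rewrite inE => /orP[/eqP //|zs].
case/splitPr: zs pth un => s1 s2 pth un; exfalso.
apply: (acyc (x :: y :: rcons s1 z)); first by rewrite /= size_rcons.
apply/andP; split.
  rewrite /cycle -rcons_cons rcons_path last_cons last_rcons -(esym x) exz.
  rewrite andbT.
  by move: pth; rewrite -cat_rcons -cat_cons cat_path => /andP[].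
by move: un; rewrite -cat_rcons -!cat_cons cat_uniq => /and3P[].
Qed.

(** If no vertex is pendent, the first vertex of a path always has a neighbour
other than its successor; by [tree_chord] this neighbour is off the path, so
there are simple paths of every length. *)
Lemma tree_has_pendent n (e : rel 'I_n.+2) :
  is_tree e -> exists p, pendent e p.
Proof.
move=> treeT; have [_ esym eirr conn _] := treeT.
case: (pickP (pendent e)) => [p pp|nopend]; first by exists p.
suff long (k : nat) : exists x y s,
    [/\ path e x (y :: s), uniq (x :: y :: s) & size s = k].
  have [x [y [s [_ un sz]]]] := long n.+2.
  have := max_card (mem (x :: y :: s)).
  by rewrite (card_uniqP un) card_ord /= sz !ltnS ltnNge leqW.
elim: k => [|k [x [y [s [pth un sz]]]]].
  case/connectP: (conn ord0 ord_max) => [[|y s] /=]; first by move=> _ /eqP.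
  case/andP=> e0y _ _; exists ord0, y, [::]; split; rewrite /= ?e0y //.
  by rewrite inE andbT; apply: contraTneq e0y => <-; rewrite eirr.
have exy : e x y by case/andP: pth.
(* y is one neighbour of x, and x is not pendent, so there is another one. *)
have [z exz zy] : exists2 z, e x z & z != y.
  case: (pickP (fun z => e x z && (z != y))) => [z /andP[]|none].
    by exists z.
  suff : pendent e x by rewrite nopend.
  apply/pendentP; exists y => // w exw; apply/eqP.
  by have := none w; rewrite exw => /negbFE.
exists z, x, (y :: s); split; last by rewrite /= sz.
  by apply/andP; split; first rewrite esym.
rewrite cons_uniq un andbT inE negb_or; apply/andP; split.
  by apply: contraTneq exz => ->; rewrite eirr.
by apply: contra zy => /(tree_chord treeT pth un exz) ->.
Qed.

Definition del_vertex n (e : rel 'I_n.+1) (p : 'I_n.+1) : rel 'I_n :=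
  relpre (lift p) e.

Lemma lift_seq n (p : 'I_n.+1) (s : seq 'I_n.+1) :
  p \notin s -> exists t : seq 'I_n, s = map (lift p) t.
Proof.
elim: s => [|x s IHs]; first by exists [::].
rewrite inE negb_or => /andP[px /IHs[t ->]].
by case: (unliftP p x) px => [j ->|->]; rewrite ?eqxx //; exists (j :: t).
Qed.

(** A simple path between two other vertices cannot pass through p: it would
enter and leave p by its only edge. *)
Lemma del_pendent_tree n (e : rel 'I_n.+2) (p : 'I_n.+2) :
  is_tree e -> pendent e p -> is_tree (del_vertex e p).
Proof.
move=> [_ esym eirr conn acyc] /pendentP[q epq uq]; split=> //.
- by move=> x y; apply: esym.
- by move=> x; apply: eirr.
- move=> x y; have /connectP[s0 pth0 lst0] := conn (lift p x) (lift p y).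
  case: (shortenP pth0) lst0 => s pth un _ lst.
  have ps : p \notin s.
    apply/negP=> ps; case/splitPr: ps pth un lst => s1 [|z s2].
      by rewrite last_cat => _ _ /eqP; rewrite eq_sym (negbTE (neq_lift _ _)).
    rewrite cat_path => /andP[_ /and3P[elp epz _]] un _.
    have zl : z = last (lift p x) s1.
      by rewrite (uq z epz) (uq (last _ s1)) // esym.
    move: un.
    rewrite -cat_cons cat_uniq => /and3P[_ /hasPn/(_ z)].
    (* The vertices just before and just after p coincide. *)
    have zin : z \in [:: p, z & s2] by rewrite !inE eqxx orbT.
    by move=> /(_ zin)/negP[]; rewrite zl; apply: mem_last.
  have [t ts] := lift_seq ps; apply/connectP; exists t.
    by move: pth; rewrite ts path_map.
  by apply: (@lift_inj _ p); rewrite lst ts last_map.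
- move=> c sc /andP[cyc un]; apply: (acyc (map (lift p) c)).
    by rewrite size_map.
  by rewrite /ucycle cycle_map map_inj_uniq; [apply/andP|apply: lift_inj].
Qed.

Lemma pendent_del n (e : rel 'I_n.+1) (p : 'I_n.+1) (v : 'I_n) :
  ~~ e (lift p v) p -> pendent (del_vertex e p) v = pendent e (lift p v).
Proof.
move=> nvp; rewrite /pendent.
rewrite -(card_imset _ (@lift_inj _ p)); congr (_ == _); apply: eq_card => w.
rewrite inE; apply/imsetP/idP => [[u]|evw]; first by rewrite inE => ? ->.
case: (unliftP p w) evw => [u ->|->]; last by rewrite (negbTE nvp).
by exists u; rewrite ?inE.
Qed.

Lemma hamiltonian_head_pendent n (e : rel 'I_n) (x y : 'I_n) (s : seq 'I_n) :
  is_tree e -> path e x (y :: s) -> uniq (x :: y :: s) ->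
  (forall z, z \in x :: y :: s) -> pendent e x.
Proof.
move=> treeT pth un cov; have [_ _ eirr _ _] := treeT.
apply/pendentP; exists y => [|w exw]; first by case/andP: pth.
apply: (tree_chord treeT pth un exw).
by have := cov w; rewrite inE => /orP[/eqP wx|//]; rewrite wx eirr in exw.
Qed.

Lemma rev_path_sym (T : eqType) (e : rel T) (x : T) (s : seq T) :
  symmetric e -> path e x s -> path e (last x s) (rev (belast x s)).
Proof. by move=> esym; rewrite rev_path (eq_path (e' := e)) // => y z. Qed.

Lemma hamiltonian_pendent_path n (e : rel 'I_n) (x y : 'I_n) s :
  is_tree e -> path e x (y :: s) -> uniq (x :: y :: s) ->
  (forall z, z \in x :: y :: s) -> pendent_path e (x :: y :: s).
Proof.
move=> treeT pth un cov; exists x, (y :: s); split=> //.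
split; first exact: hamiltonian_head_pendent cov.
  have [_ esym _ _ _] := treeT.
  move: pth un cov => /(rev_path_sym esym); set t := y :: s => pth un cov.
  have rE : last x t :: rev (belast x t) = rev (x :: t).
    by rewrite -rev_rcons -lastI.
  move: un cov; rewrite -rev_uniq -rE => un cov.
  have {}cov z : z \in last x t :: rev (belast x t).
    by rewrite rE mem_rev.
  case: (rev (belast x t)) (size_rev (belast x t)) pth un cov => [|w r].
    by rewrite size_belast.
  by move=> _; apply: hamiltonian_head_pendent.
by move: un => /andP[xs _]; apply: contraNneq xs => ->; apply: (mem_last y s).
Qed.

(** Put back a pendent vertex p with neighbour q.  Of three pendent vertices of
the smaller tree at most one is q, so at least two stay pendent.  If the smaller
tree is a path, then p prolongs it when q is one of its ends, and otherwise both
ends stay pendent, which makes three with p. *)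
Lemma tree_three_pendent_or_path n (e : rel 'I_n.+1) : is_tree e ->
  (exists p q r, [/\ pendent e p, pendent e q, pendent e r & uniq [:: p; q; r]])
  \/ exists x s, [/\ path e x s, uniq (x :: s) & forall z, z \in x :: s].
Proof.
elim: n e => [|n IHn] e treeT.
  by right; exists ord0, [::]; split=> // z; rewrite inE (ord1 z).
have [p pp] := tree_has_pendent treeT.
have /pendentP[q0 epq0 uq0] := pp; have [_ esym eirr _ _] := treeT.
case: (unliftP p q0) epq0 uq0 => [q ->|->] epq uq; last by rewrite eirr in epq.
have Pdel v : v != q -> pendent (del_vertex e p) v -> pendent e (lift p v).
  move=> vq; rewrite pendent_del // esym; apply: contra vq => /uq.
  by move=> /lift_inj ->.
have treeT' := del_pendent_tree treeT pp.
have three a b : pendent (del_vertex e p) a -> pendent (del_vertex e p) b ->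
    [&& a != q, b != q & a != b] ->
    exists p q r, [/\ pendent e p, pendent e q, pendent e r & uniq [:: p; q; r]].
  move=> pa pb /and3P[aq bq ab]; exists p, (lift p a), (lift p b).
  split=> //; try exact: Pdel.
  by rewrite /= !inE !(inj_eq lift_inj) negb_or !neq_lift ab.
case: (IHn _ treeT') => [[a [b [c [pa pb pc]]]]|[x [s [pth un cov]]]].
  rewrite /= !inE negb_or andbT => /andP[/andP[ab ac] bc]; left.
  have [aq|aq] := eqVneq a q.
    apply: (three b c) => //.
    by rewrite bc andbT -aq eq_sym ab eq_sym ac.
  have [bq|bq] := eqVneq b q; last by apply: (three a b) => //; apply/and3P.
  by apply: (three a c) => //; rewrite aq ac -bq eq_sym bc.
have upath t : uniq t -> uniq (p :: map (lift p) t).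
  move=> ut; rewrite /= (map_inj_uniq (@lift_inj _ p)) ut andbT.
  by apply/mapP=> -[j _ /eqP]; rewrite (negbTE (neq_lift _ _)).
have ucov z : z \in p :: map (lift p) (x :: s).
  case: (unliftP p z) => [j ->|->]; last by rewrite inE eqxx.
  by rewrite inE (mem_map (@lift_inj _ p)) cov orbT.
have [xq|xq] := eqVneq x q.
  right; exists p, (map (lift p) (x :: s)); split=> //; last exact: upath.
  by rewrite /= xq epq path_map -xq.
have [lq|lq] := eqVneq (last x s) q.
  right; exists (lift p x), (rcons (map (lift p) s) p); split.
  - by rewrite rcons_path path_map pth last_map lq esym.
  - by rewrite -rcons_cons rcons_uniq; apply: (upath (x :: s)).
  - by move=> z; rewrite -rcons_cons mem_rcons ucov.
left; case: s => [|y s] in pth un cov upath ucov lq *.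
  by have := cov q; rewrite inE eq_sym (negbTE xq).
have [_ [_ [[<- <-] _ _ [px pl xl]]]] :=
  hamiltonian_pendent_path treeT' pth un cov.
by apply: (three x (last x (y :: s))) => //; apply/and3P.
Qed.

(** * Heredity of T-positivity *)

Lemma row'_col'_mxsub (R : Type) n (p : 'I_n) (A : 'M[R]_n) :
  row' p (col' p A) = mxsub (lift p) (lift p) A.
Proof. by apply/matrixP=> i j; rewrite !mxE. Qed.

Lemma lift_homo n (p : 'I_n) : {homo lift p : i j / (i < j)%N}.
Proof. by move=> i j ij; rewrite /= !ltnNge leq_bump2 -ltnNge. Qed.

Lemma totally_positive_infix (R : realType) m n (F : 'I_m -> 'I_n)
    (A : 'M[R]_n) (s : seq 'I_m) (u v : seq 'I_n) :
  totally_positive (princ_submx A (u ++ map F s ++ v)) ->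
  totally_positive (princ_submx (mxsub F F A) s).
Proof.
set t := u ++ map F s ++ v => tp k f g fi gi.
have lt i : (i < size s)%N -> (size u + i < size t)%N.
  by move=> si; rewrite !size_cat size_map ltn_add2l ltn_addr.
pose h (i : 'I_(size s)) := Ordinal (lt i (ltn_ord i)).
have hE i : tnth (in_tuple t) (h i) = F (tnth (in_tuple s) i).
  have d : 'I_m := tnth (in_tuple s) i.
  rewrite (tnth_nth (F d)) (tnth_nth d) /= nth_cat.
  rewrite ltnNge leq_addr /= addKn nth_cat size_map ltn_ord.
  by rewrite (nth_map d).
have := tp k (h \o f) (h \o g); set D := mxsub _ _ _; set E := mxsub _ _ _.
suff -> : D = E.
  by apply=> i j ij /=; rewrite ltn_add2l; [apply: fi|apply: gi].
by apply/matrixP=> i j; rewrite !mxE !hE.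
Qed.

Lemma P_matrix_del (R : realType) n (A : 'M[R]_n) (p : 'I_n) :
  P_matrix A -> P_matrix (row' p (col' p A)).
Proof.
move=> PA k f fi; rewrite row'_col'_mxsub -mxsub_comp; apply: PA => i j ij.
by apply: lift_homo; apply: fi.
Qed.

(** Total positivity along a path passes to its subpaths, so it is enough to
see a path between pendent vertices of the smaller tree inside a path between
pendent vertices of the larger one.  The only possibly new pendent vertex is the
neighbour of p, and then p can be added beyond it.  Only one end is concerned,
since p has a single neighbour. *)
Lemma T_positive_del (R : realType) n (e : rel 'I_n.+1) (A : 'M[R]_n.+1)
    (p : 'I_n.+1) :
  symmetric e -> pendent e p -> T_positive e A ->
  T_positive (del_vertex e p) (row' p (col' p A)).
Proof.
move=> esym pp [tA pA]; split=> [s|v _]; last exact: P_matrix_del (pA p pp).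
case=> x [t [-> {s} pth un [px pl xl]]]; rewrite row'_col'_mxsub.
have [q epq uq] := pendentP _ _ pp.
have pth' : path e (lift p x) (map (lift p) t) by rewrite path_map.
have un' : uniq (map (lift p) (x :: t)).
  by rewrite map_inj_uniq //; apply: lift_inj.
have pnot : p \notin map (lift p) (x :: t).
  by apply/mapP=> -[j _ /eqP]; rewrite (negbTE (neq_lift _ _)).
have lE : last (lift p x) (map (lift p) t) = lift p (last x t).
  by rewrite last_map.
have other a b : e p (lift p a) -> a != b -> pendent (del_vertex e p) b ->
    pendent e (lift p b).
  move=> /uq aq ab; rewrite pendent_del // esym; apply: contra ab => /uq.
  by rewrite -aq => /lift_inj ->.
have [epx|nepx] := boolP (e p (lift p x)).
  apply: (@totally_positive_infix _ _ _ _ A (x :: t) [:: p] [::]).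
  rewrite cats0; apply: tA; exists p, (map (lift p) (x :: t)); split=> //=.
  - by rewrite epx.
  - by rewrite pnot.
  - by rewrite lE neq_lift; split=> //; apply: other epx xl pl.
have px' : pendent e (lift p x) by rewrite -pendent_del // esym.
have [epl|nepl] := boolP (e p (lift p (last x t))).
  apply: (@totally_positive_infix _ _ _ _ A (x :: t) [::] [:: p]).
  apply: tA; exists (lift p x), (rcons (map (lift p) t) p); split=> //=.
  - by rewrite cats1.
  - by rewrite rcons_path pth' lE esym.
  - rewrite -[_ && _]/(uniq (rcons (map (lift p) (x :: t)) p)).
    by rewrite rcons_uniq pnot.
  - by rewrite last_rcons eq_sym neq_lift.
apply: (@totally_positive_infix _ _ _ _ A (x :: t) [::] [::]).
rewrite cats0; apply: tA; exists (lift p x), (map (lift p) t); split=> //=.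
rewrite lE (inj_eq lift_inj) px' xl; split=> //.
by rewrite -pendent_del // esym.
Qed.

(** * Inverses, pivots and signs *)

Lemma invmxP (F : fieldType) n (A B : 'M[F]_n) : A *m B = 1%:M -> invmx A = B.
Proof.
move=> AB; have [uA _] := mulmx1_unit AB.
by rewrite -[RHS](mulKmx uA) AB mulmx1.
Qed.

Lemma invmx_diag (F : fieldType) n (A : 'M[F]_n) (p : 'I_n) :
  A \in unitmx -> invmx A p p = \det (row' p (col' p A)) / \det A.
Proof.
move=> uA; rewrite /invmx uA !mxE /cofactor -signr_odd addnn odd_double.
by rewrite mul1r mulrC.
Qed.

(** The Schur complement C of B(p,p) in B = A^-1 is obtained from B by column
operations that clear row p.  Hence row p does not contribute to the product of
A with the cleared columns, and A(p) C is the identity. *)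
Lemma invmx_del (F : fieldType) n (A : 'M[F]_n.+1) (p : 'I_n.+1) :
  A \in unitmx -> invmx A p p != 0 ->
  forall i j, invmx (row' p (col' p A)) i j =
    invmx A (lift p i) (lift p j)
    - invmx A (lift p i) p * invmx A p (lift p j) / invmx A p p.
Proof.
move=> uA; set B := invmx A => Bpp i j.
pose C : 'M_n := \matrix_(i, j)
  (B (lift p i) (lift p j) - B (lift p i) p * B p (lift p j) / B p p).
rewrite (@invmxP _ _ _ C) ?mxE // {i j}; apply/matrixP=> i j.
pose c k := B k (lift p j) - B k p * B p (lift p j) / B p p.
have AB k l : \sum_m A k m * B m l = (k == l)%:R.
  by have /matrixP/(_ k l) := mulmxV uA; rewrite !mxE.
transitivity (\sum_k A (lift p i) k * c k).
  rewrite (bigD1_ord p) //= {1}/c mulrAC divff // mul1r subrr mulr0 add0r.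
  by rewrite mxE; apply: eq_bigr => k _; rewrite !mxE.
transitivity (\sum_k A (lift p i) k * B k (lift p j)
    - (\sum_k A (lift p i) k * B k p) * (B p (lift p j) / B p p)).
  rewrite mulr_suml -sumrB; apply: eq_bigr => k _.
  by rewrite /c mulrBr !mulrA.
rewrite !AB (inj_eq lift_inj) [lift p i == p]eq_sym (negbTE (neq_lift _ _)).
by rewrite mul0r subr0 mxE.
Qed.

Lemma opposite_ratios (R : realFieldType) (x y a b s t : R) :
  0 < x -> 0 < y -> 0 < a -> 0 < b -> x * a < s * y -> y * b < t * x ->
  a * b < s * t.
Proof.
move=> x0 y0 a0 b0 h1 h2.
rewrite -(ltr_pM2l (mulr_gt0 x0 y0)).
have -> : x * y * (a * b) = (x * a) * (y * b) by ring.
have -> : x * y * (s * t) = (s * y) * (t * x) by ring.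
by apply: ltr_pM => //; rewrite ltW // mulr_gt0.
Qed.

(** First take distinct p, q, r in L and suppose b(p,q) <= 0.  The inequality at
(p,q) with pivot r makes b(p,r) and b(r,q) nonzero of opposite signs.  In either
case a second pivot inequality bounds the same ratio of two entries of row p or
column q from the other side, and the product of the two bounds
([opposite_ratios]) contradicts a diagonal inequality such as
b(p,r) b(r,p) < b(p,p) b(r,r).  Once b(p,q) and b(q,p) are positive, the same
argument with the pivots p and q gives the positivity of column p and of row p,
and then b(i,p) b(p,j) < b(i,j) b(p,p) gives every other entry. *)
Lemma three_pivots_positive (R : realFieldType) (T : eqType) (L : pred T)
    (b : T -> T -> R) (p q r : T) :
  (forall l, L l -> 0 < b l l) ->
  (forall l i j, L l -> i != l -> j != l -> b i l * b l j < b i j * b l l) ->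
  L p -> L q -> L r -> uniq [:: p; q; r] -> forall i j, 0 < b i j.
Proof.
move=> diag piv.
have offL x y z : L x -> L y -> L z -> uniq [:: x; y; z] -> 0 < b x y.
  move=> Lx Ly Lz; rewrite /= !inE negb_or andbT => /andP[/andP[xy xz] yz].
  have [yx zx zy] : [/\ y != x, z != x & z != y] by split; rewrite eq_sym.
  have [dx dy dz] : [/\ 0 < b x x, 0 < b y y & 0 < b z z].
    by split; apply: diag.
  rewrite ltNge; apply/negP=> bxy.
  have h1 := piv z x y Lz xz yz.
  have : b x z * b z y < 0.
    by apply: (lt_le_trans h1); rewrite pmulr_lle0.
  case: (ltrgt0P (b z y)) => bzy; last by rewrite bzy mulr0 ltxx.
    rewrite pmulr_llt0 // => bxz.
    have h2 := piv y x z Ly xy zy.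
    have h3 : b x y * b y z < 0.
      by apply: (lt_trans h2); rewrite nmulr_rlt0.
    have bxy' : b x y < 0.
      rewrite lt_neqAle bxy andbT; apply: contraTneq h3 => ->.
      by rewrite mul0r ltxx.
    have h4 := piv y z z Ly zy zy.
    suff : b z z * b y y < b z y * b y z by rewrite ltNge ltW.
    apply: (@opposite_ratios _ (- b x y) (- b x z)); rewrite ?oppr_gt0 //.
      by rewrite mulrN mulNr ltrN2 [b z y * _]mulrC.
    by rewrite mulrN mulNr ltrN2 [b y z * _]mulrC.
  rewrite nmulr_llt0 // => bxz.
  have h2 := piv x z y Lx zx yx.
  have h3 : b z x * b x y < 0.
    by apply: (lt_trans h2); rewrite pmulr_llt0.
  have bxy' : b x y < 0.
    rewrite lt_neqAle bxy andbT; apply: contraTneq h3 => ->.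
    by rewrite mulr0 ltxx.
  have h4 := piv x z z Lx zx zx.
  suff : b z z * b x x < b x z * b z x by rewrite [b x z * _]mulrC ltNge ltW.
  apply: (@opposite_ratios _ (- b x y) (- b z y)); rewrite ?oppr_gt0 //.
    by rewrite mulrN mulNr ltrN2.
  by rewrite mulrN mulNr ltrN2.
move=> Lp Lq Lr un.
have [bpq bqp] : 0 < b p q /\ 0 < b q p.
  split; first exact: (offL p q r).
  apply: (offL q p r) => //; move: un.
  by rewrite /= !inE !negb_or [q == p]eq_sym; case/and3P=> /andP[-> ->] ->.
have pq : p != q by move: un; rewrite /= inE negb_or; case/andP=> /andP[].
have qp : q != p by rewrite eq_sym.
have dp := diag p Lp; have dq := diag q Lq.
have hpq := piv q p p Lq pq pq.
have col i : 0 < b i p.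
  have [->//|ip] := eqVneq i p.
  have [->//|iq] := eqVneq i q.
  have h1 := piv q i p Lq iq pq; have h2 := piv p i q Lp ip qp.
  rewrite ltNge; apply/negP=> bip.
  have biq : b i q < 0.
    rewrite -(pmulr_llt0 _ bqp); apply: (lt_le_trans h1).
    by rewrite pmulr_lle0.
  have bip' : b i p < 0.
    rewrite -(pmulr_llt0 _ bpq); apply: (lt_trans h2).
    by rewrite pmulr_llt0.
  suff : b p p * b q q < b p q * b q p by rewrite ltNge ltW.
  rewrite mulrC [b p q * _]mulrC.
  apply: (@opposite_ratios _ (- b i p) (- b i q)); rewrite ?oppr_gt0 //.
    by rewrite mulrN mulNr ltrN2 mulrC.
  by rewrite mulrN mulNr ltrN2 mulrC.
have row j : 0 < b p j.
  have [->//|jp] := eqVneq j p.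
  have [->//|jq] := eqVneq j q.
  have h1 := piv q p j Lq pq jq; have h2 := piv p q j Lp qp jp.
  rewrite ltNge; apply/negP=> bpj.
  have bqj : b q j < 0.
    rewrite -(pmulr_rlt0 _ bpq); apply: (lt_le_trans h1).
    by rewrite pmulr_lle0.
  have bpj' : b p j < 0.
    rewrite -(pmulr_rlt0 _ bqp); apply: (lt_trans h2).
    by rewrite pmulr_llt0.
  suff : b p p * b q q < b p q * b q p by rewrite ltNge ltW.
  rewrite mulrC.
  apply: (@opposite_ratios _ (- b p j) (- b q j)); rewrite ?oppr_gt0 //.
    by rewrite mulrN mulNr ltrN2.
  by rewrite mulrN mulNr ltrN2.
move=> i j.
have [->|ip] := eqVneq i p; first exact: row.
have [->|jp] := eqVneq j p; first exact: col.
rewrite -(pmulr_lgt0 _ dp); apply: (lt_trans _ (piv p i j Lp ip jp)).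
by rewrite mulr_gt0.
Qed.

(** The sign of the cofactor cancels (-1)^(i+j), and what remains is a quotient
of two minors of M. *)
Lemma totally_positive_invmx (R : realType) m (M : 'M[R]_m) (i j : 'I_m) :
  totally_positive M -> 0 < (-1) ^+ (i + j) * invmx M i j.
Proof.
move=> tp.
have detM : 0 < \det M.
  by have := tp m id id (fun _ _ => id) (fun _ _ => id); rewrite mxsub_id.
have uM : M \in unitmx by rewrite unitmxE unitfE gt_eqF.
rewrite /invmx uM !mxE /cofactor mulrCA pmulr_rgt0 ?invr_gt0 // mulrA.
rewrite -exprD [(j + i)%N]addnC addnn -signr_odd odd_double mul1r.
have -> : row' j (col' i M) = mxsub (lift j) (lift i) M.
  by apply/matrixP=> a b; rewrite !mxE.
by apply: tp; apply: lift_homo.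
Qed.

Lemma invmx_mxsub_bij (F : fieldType) m n (f : 'I_m -> 'I_n) (A : 'M[F]_n) :
  bijective f -> A \in unitmx ->
  invmx (mxsub f f A) = mxsub f f (invmx A).
Proof.
move=> bf uA; apply: invmxP; apply/matrixP=> i j; rewrite !mxE.
have /matrixP/(_ (f i) (f j)) := mulmxV uA.
rewrite !mxE (inj_eq (bij_inj bf)) => <-.
rewrite [RHS](reindex f); last exact: onW_bij.
by apply: eq_bigr => k _; rewrite !mxE.
Qed.

Lemma sign_along_path (R : realType) n (e : rel 'I_n) (sigma : 'rV[R]_n) x s k :
  (forall i j, e i j -> sigma 0 i = - sigma 0 j) -> path e x s ->
  (k <= size s)%N -> sigma 0 (nth x (x :: s) k) = (-1) ^+ k * sigma 0 x.
Proof.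
move=> alt pth; elim: k => [|k IHk] ks; first by rewrite mul1r.
rewrite exprS -mulrA -IHk ?(ltnW ks) // mulN1r.
by rewrite (alt _ _ ((pathP x pth) k ks)) opprK.
Qed.

(** Induction by deletion of pendent vertices: three of them provide the pivots
of [three_pivots_positive]; otherwise the tree is a path, and sigma alternates
along it. *)
Lemma signed_inverse_positive (R : realType) n (e : rel 'I_n) (A : 'M[R]_n)
    (sigma : 'rV[R]_n) :
  is_tree e -> T_positive e A -> 0 < \det A -> signed_according e sigma ->
  forall i j, 0 < sigma 0 i * invmx A i j * sigma 0 j.
Proof.
case: n => [|n] in e A sigma *; first by case.
elim: n => [|n IHn] in e A sigma *.
  move=> _ _ detA [sg _] i j; rewrite (ord1 i) (ord1 j) mulrAC -expr2.
  have uA : A \in unitmx by rewrite unitmxE unitfE gt_eqF.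
  have -> : sigma 0 0 ^+ 2 = 1 by case: (sg 0) => ->; rewrite ?sqrrN expr1n.
  by rewrite mul1r invmx_diag // det_mx00 div1r invr_gt0.
move=> treeT TA detA [sg alt].
have [_ esym _ _ _] := treeT; have [tA pA] := TA.
have uA : A \in unitmx by rewrite unitmxE unitfE gt_eqF.
have sq k : sigma 0 k * sigma 0 k = 1.
  by case: (sg k) => ->; rewrite ?mulrNN mulr1.
have [[p [q [r [pp pq pr un]]]]|[x [s [pth un cov]]]] :=
    tree_three_pendent_or_path treeT.
  have detl l : pendent e l -> 0 < \det (row' l (col' l A)).
    move=> pl; have := pA l pl _ id (fun _ _ => id).
    by rewrite mxsub_id.
  have dl l : pendent e l -> 0 < invmx A l l.
    by move=> pl; rewrite invmx_diag // divr_gt0 // detl.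
  apply: (@three_pivots_positive _ _ (pendent e)
    (fun i j => sigma 0 i * invmx A i j * sigma 0 j) p q r) => // l.
    by move=> /dl; rewrite mulrAC sq mul1r.
  move=> i j pl il jl; have d := dl l pl.
  case: (unliftP l i) il => [i' ->|->]; last by rewrite eqxx.
  case: (unliftP l j) jl => [j' ->|->]; last by rewrite eqxx.
  move=> _ _; pose sigma' : 'rV_n.+1 := \row_k sigma 0 (lift l k).
  have sg' : signed_according (del_vertex e l) sigma'.
    by split=> [k|k m ekm]; rewrite !mxE; [apply: sg|apply: alt].
  have := IHn _ _ _ (del_pendent_tree treeT pl)
    (T_positive_del esym pl TA) (detl l pl) sg' i' j'.
  (* The positive entry of the signed inverse of A(l), multiplied by the pivot,
     is the pivot inequality: the two signs at l multiply to 1. *)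
  rewrite !mxE (invmx_del _ (lt0r_neq0 d)) // => h; rewrite -subr_gt0.
  apply: etrans (mulr_gt0 h d); congr (0 < _).
  by rewrite -[RHS]mul1r -(sq l); field; apply: lt0r_neq0.
have [y [s' sE]] : exists y s', s = y :: s'.
  case: s cov {pth un} => [cov|y s' _]; last by exists y, s'.
  by have := cov ord0; have := cov ord_max; rewrite !inE => /eqP <- /eqP.
have tp : totally_positive (princ_submx A (x :: s)).
  by apply: tA; move: pth un cov; rewrite sE; apply: hamiltonian_pendent_path.
pose f := tnth (in_tuple (x :: s)).
have bf : bijective f.
  have inj : injective f by apply/tuple_uniqP.
  apply: inj_card_bij => //; rewrite !card_ord -[X in (X <= _)%N]card_ord.
  have <- : #|x :: s| = #|'I_n.+2| by apply: eq_card => z; rewrite cov.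
  exact: card_size.
have sf k : sigma 0 (f k) = (-1) ^+ k * sigma 0 x.
  by rewrite /f (tnth_nth x) (sign_along_path alt pth) // -ltnS.
move=> i j; have [g _ gK] := bf.
rewrite -(gK i) -(gK j) !sf.
have := totally_positive_invmx (g i) (g j) tp.
rewrite /princ_submx invmx_mxsub_bij // mxE exprD -/f.
by apply: etrans; congr (0 < _); rewrite -[RHS]mulr1 -(sq x); ring.
Qed.

(** * Perron's theorem *)

Lemma positive_lower_bound (R : realFieldType) n (g : 'I_n -> R) :
  (forall i, 0 < g i) -> exists2 eps, 0 < eps & forall i, eps <= g i.
Proof.
case: n g => [|n] g g0; first by exists 1 => // -[].
case: (arg_minP g (erefl : xpredT ord0)) => i _ gi.
by exists (g i) => // j; apply: gi.
Qed.

(** A supersolution w certifies that t - M is a nonsingular M-matrix when the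
entries of M are nonnegative. *)
Definition supersolution (R : realFieldType) n (M : 'M[R]_n) (t : R)
    (w : 'cV[R]_n) : Prop :=
  (forall i, 0 < w i 0) /\ (forall i, (M *m w) i 0 < t * w i 0).

(** If x had a negative entry, the smallest ratio c = x(m) / w(m) would be
negative, and (M x)(m) >= c (M w)(m) > c t w(m) = t x(m). *)
Lemma minimum_principle (R : realFieldType) n (M : 'M[R]_n) t (w x : 'cV_n) :
  (forall i j, 0 <= M i j) -> supersolution M t w ->
  (forall i, (M *m x) i 0 <= t * x i 0) -> forall i, 0 <= x i 0.
Proof.
move=> M0 [w0 Mw] Mx i; rewrite leNgt; apply/negP=> xi.
have := arg_minP (fun k => x k 0 / w k 0) (erefl : xpredT i).
case=> m _ min; pose c := x m 0 / w m 0.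
have c0 : c < 0.
  by apply: le_lt_trans (min i isT) _; rewrite pmulr_llt0 ?invr_gt0.
have xm : x m 0 = c * w m 0 by rewrite divfK // gt_eqF.
have := Mx m; apply/negP; rewrite -ltNge xm mulrCA.
apply: (@lt_le_trans _ _ (c * (M *m w) m 0)); first by rewrite ltr_nM2l.
rewrite !mxE mulr_sumr; apply: ler_sum => k _.
by rewrite mulrCA ler_wpM2l // -ler_pdivlMr //; apply: min.
Qed.

(** Finitely many strict inequalities leave a common slack. *)
Lemma supersolution_open (R : realFieldType) n (M : 'M[R]_n) t w :
  supersolution M t w -> exists2 t', t' < t & supersolution M t' w.
Proof.
move=> [w0 Mw].
have [|eps eps0 le_eps] :=
    @positive_lower_bound _ _ (fun i => (t * w i 0 - (M *m w) i 0) / w i 0).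
  by move=> i; rewrite divr_gt0 // subr_gt0.
exists (t - eps / 2); first by rewrite ltrBlDr ltrDl divr_gt0.
split=> // i; have := le_eps i; rewrite ler_pdivlMr // => le_i.
have := mulr_gt0 eps0 (w0 i); lra.
Qed.

Lemma horner_ge0_right (R : rcfType) (p : {poly R}) (a : R) :
  (forall t, a < t -> 0 <= p.[t]) -> 0 <= p.[a].
Proof.
move=> p0; rewrite leNgt; apply/negP=> pa.
have [|d d0 near_a] := @poly_cont R a p (- p.[a]); first by rewrite oppr_gt0.
have ad : a < a + d / 2 by rewrite ltrDl divr_gt0.
have := near_a (a + d / 2); rewrite addrAC subrr add0r.
rewrite gtr0_norm ?divr_gt0 // ltr_pdivrMr // ltr_pMr // ltr1n => /(_ isT).
by rewrite ltr_norml => /andP[_]; have := p0 _ ad; lra.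
Qed.

Lemma positive_mulmx_gt0 (R : realFieldType) n (M : 'M[R]_n) (y : 'cV_n) :
  (forall i j, 0 < M i j) -> (forall i, 0 <= y i 0) -> y != 0 ->
  forall i, 0 < (M *m y) i 0.
Proof.
move=> M0 y0 /matrix0Pn[k [j]]; rewrite (ord1 j) => yk i.
rewrite mxE (bigD1 k) //= ltr_wpDr //.
  by apply: sumr_ge0 => l _; rewrite mulr_ge0 // ltW.
by rewrite mulr_gt0 // lt_def yk y0.
Qed.

(** The value rho is the infimum of the t that admit a supersolution.  The
adjugate provides v(t) with (t - M) v(t) = det(t - M)^2 (1, ..., 1), whether or
not t - M is invertible.  It is nonnegative for t > rho by the minimum
principle, hence also for t = rho, because its entries are polynomials in t.  If
det(rho - M) were not 0, then v(rho) would be a supersolution for rho, and so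
for some t < rho. *)
Lemma perron_vector (R : realType) n (M : 'M[R]_n.+1) :
  (forall i j, 0 < M i j) ->
  exists rho (x : 'cV_n.+1),
    [/\ 0 < rho, forall i, 0 < x i 0 & M *m x = rho *: x].
Proof.
move=> M0; have M0' i j : 0 <= M i j by apply: ltW.
pose S : classical_sets.set R := fun t => exists w, supersolution M t w.
have S0 t : S t -> 0 <= t.
  case=> w [w0 /(_ 0) Mw]; rewrite -(pmulr_lge0 _ (w0 0)) ltW //.
  apply: le_lt_trans Mw; rewrite mxE; apply: sumr_ge0 => j _.
  by rewrite mulr_ge0 // ltW.
have S_up t t' : S t -> t <= t' -> S t'.
  move=> [w [w0 Mw]] tt'; exists w; split=> // i.
  by apply: lt_le_trans (Mw i) _; rewrite ler_wpM2r // ltW.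
have hasS : classical_sets.has_inf S.
  split; last by exists 0.
  exists (1 + \sum_i (M *m const_mx 1 : 'cV_n.+1) i 0), (const_mx 1); split.
    by move=> i; rewrite mxE.
  move=> i; rewrite [const_mx 1 i 0]mxE mulr1 (bigD1 i) //= addrCA ltrDl.
  rewrite ltr_pwDl //; apply: sumr_ge0 => k _; rewrite mxE.
  by apply: sumr_ge0 => j _; rewrite !mxE mulr1.
pose rho := inf S.
have rho0 : 0 <= rho by apply: lb_le_inf => //; case: hasS.
have above t : rho < t -> S t.
  rewrite -subr_gt0 => /inf_adherent/(_ hasS)[s Ss]; rewrite addrC subrK.
  by move=> /ltW; apply: S_up.
have below t : S t -> rho <= t by apply: ge_inf; case: hasS.
pose ones : 'cV[R]_n.+1 := const_mx 1.
pose d t := \det (t%:M - M).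
pose v t : 'cV_n.+1 := d t *: (\adj (t%:M - M) *m ones).
have vE t i : (M *m v t) i 0 = t * v t i 0 - d t ^+ 2.
  have : (t%:M - M) *m v t = (d t ^+ 2) *: ones.
    by rewrite -scalemxAr mulmxA mul_mx_adj mul_scalar_mx scalerA.
  rewrite mulmxBl mul_scalar_mx => /matrixP/(_ i 0).
  rewrite [in RHS]mxE [in RHS]mxE mulr1 !(mxE _ _ i 0) => <-.
  by rewrite opprB addrCA subrr addr0.
have v0 t i : rho < t -> 0 <= v t i 0.
  move=> /above[w Sw]; apply: (minimum_principle M0' Sw) => {}i.
  by rewrite vE gerBl sqr_ge0.
have det0 : d rho = 0.
  apply/eqP/negPn/negP=> dn0.
  have hom t : map_mx (horner_eval t) (char_poly_mx M) = t%:M - M.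
    apply/matrixP=> i j; rewrite !mxE /horner_eval !hornerE.
    by case: eqP; rewrite ?hornerE.
  have vrho i : 0 <= v rho i 0.
    pose p := char_poly M * \sum_j \adj (char_poly_mx M) i j.
    have pE t : p.[t] = v t i 0.
      rewrite hornerM mxE /d -hom det_map_mx -map_mx_adj.
      congr (_ * _).
      by rewrite horner_sum mxE; apply: eq_bigr => j _; rewrite !mxE mulr1.
    by rewrite -pE; apply: horner_ge0_right => t /v0; rewrite pE.
  have d2 : 0 < d rho ^+ 2 by rewrite exprn_even_gt0.
  have Srho : supersolution M rho (v rho).
    split=> i; last by rewrite vE gtrBl.
    rewrite lt_def vrho andbT; apply: contraTneq d2 => vi.
    have := vE rho i; rewrite vi mulr0 sub0r => Mv.
    rewrite -leNgt -oppr_ge0 -Mv mxE; apply: sumr_ge0 => j _.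
    by rewrite mulr_ge0.
  have [t t_rho St] := supersolution_open Srho.
  by have := below t (ex_intro _ _ St); rewrite leNgt t_rho.
have [x xn0 Mx] : exists2 x : 'cV_n.+1, x != 0 & M *m x = rho *: x.
  have /det0P[u un0] : \det (rho%:M - M)^T == 0.
    by rewrite det_tr -/(d rho) det0.
  move=> /(congr1 trmx); rewrite trmx_mul trmxK trmx0 mulmxBl mul_scalar_mx.
  by move=> /eqP; rewrite subr_eq0 => /eqP Mu; exists u^T; rewrite ?trmx_eq0.
pose y : 'cV_n.+1 := \col_i `|x i 0|.
have y0 i : 0 <= y i 0 by rewrite mxE.
have yn0 : y != 0.
  have /matrix0Pn[i [j]] := xn0; rewrite (ord1 j) => xi.
  by apply/matrix0Pn; exists i, 0; rewrite mxE normr_eq0.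
have z0 := positive_mulmx_gt0 M0 y0 yn0.
pose gap : 'cV_n.+1 := M *m y - rho *: y.
have gapE i : gap i 0 = (M *m y) i 0 - rho * y i 0 by rewrite /gap !mxE.
have gap0 i : 0 <= gap i 0.
  rewrite gapE subr_ge0.
  have /matrixP/(_ i 0) := Mx; rewrite !mxE => xE.
  rewrite -(ger0_norm rho0) -normrM -xE.
  apply: le_trans (ler_norm_sum _ _ _) _; apply: ler_sum => j _.
  by rewrite normrM (ger0_norm (M0' _ _)) mxE.
(* If M y - rho y >= 0 is nonzero, M maps it to a positive vector, so z = M y
   satisfies (rho + eps) z <= M z for some eps > 0; then the minimum principle
   at rho + eps makes - z nonnegative. *)
have My : M *m y = rho *: y.
  apply/eqP; rewrite -subr_eq0 -/gap; apply/negPn/negP=> gapn0.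
  pose z := M *m y.
  have Mz i : rho * z i 0 < (M *m z) i 0.
    rewrite -subr_gt0; apply: etrans (positive_mulmx_gt0 M0 gap0 gapn0 i).
    congr (0 < _); rewrite /gap mulmxBr -scalemxAr -/z.
    by rewrite [RHS]mxE; congr (_ + _); rewrite !mxE.
  have [|eps eps0 le_eps] :=
      @positive_lower_bound _ _ (fun i => ((M *m z) i 0 - rho * z i 0) / z i 0).
    by move=> i; rewrite divr_gt0 // subr_gt0.
  have [w Sw] : S (rho + eps) by apply: above; rewrite ltrDl.
  have := @minimum_principle _ _ M (rho + eps) w (- z) M0' Sw _ 0.
  rewrite mulmxN !mxE => le0; have := z0 0; rewrite ltNge; apply/negP.
  rewrite negbK -oppr_ge0; move: le0; rewrite mxE; apply=> i.
  rewrite mxE [(- z) i 0]mxE mulrN lerN2 mulrDl -lerBrDl -ler_pdivlMr //.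
exists rho, y.
have ry i : 0 < rho * y i 0.
  by have := z0 i; rewrite My mxE.
have rho_gt0 : 0 < rho.
  rewrite lt_def rho0 andbT; apply: contraTneq (ry 0) => ->.
  by rewrite mul0r ltxx.
by split=> // i; rewrite -(pmulr_rgt0 _ rho_gt0).
Qed.

(** The predicate [eigenvalue] is about row vectors; a singular matrix has a
kernel on both sides. *)
Lemma eigenvalue_col (F : fieldType) n (A : 'M[F]_n) (a : F) (y : 'cV_n) :
  y != 0 -> A *m y = a *: y -> eigenvalue A a.
Proof.
move=> yn0 Ay.
have /det0P[v vn0 vA] : \det (A - a%:M) == 0.
  rewrite -det_tr; apply/det0P; exists y^T; rewrite ?trmx_eq0 //.
  by rewrite -trmx_mul mulmxBl Ay mul_scalar_mx subrr trmx0.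
apply/eigenvalueP; exists v => //; apply/eqP.
by rewrite -subr_eq0 -mul_mx_scalar -mulmxBr vA.
Qed.

(** With a = |u|, the triangle inequality gives a M >= |nu| a, and pairing with
x gives (rho - |nu|) (a x) >= 0.  If |nu| = rho, then all the triangle
inequalities are equalities.  Those of one column show that u is a unit multiple
of a, because the entries of M are positive, and so nu = |nu|. *)
Lemma perron_dominant (C : numClosedFieldType) n (M : 'M[C]_n) (x : 'cV_n)
    (u : 'rV_n) (rho nu : C) :
  (forall i j, 0 < M i j) -> (forall i, 0 < x i 0) -> M *m x = rho *: x ->
  u != 0 -> u *m M = nu *: u -> nu != rho -> `|nu| < rho.
Proof.
move=> M0 x0 Mx un0 uM nurho.
pose a j := `|u 0 j|; have a0 j : 0 <= a j by apply: normr_ge0.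
have uME j : \sum_i u 0 i * M i j = nu * u 0 j.
  by have /matrixP/(_ 0 j) := uM; rewrite !mxE.
have nE i j : `|u 0 i * M i j| = a i * M i j.
  by rewrite normrM (gtr0_norm (M0 _ _)).
pose gap j := \sum_i a i * M i j - `|nu| * a j.
have gap0 j : 0 <= gap j.
  rewrite subr_ge0 -normrM -uME; apply: le_trans (ler_norm_sum _ _ _) _.
  by apply: ler_sum => i _; rewrite nE.
have gapE : \sum_j gap j * x j 0 = (rho - `|nu|) * \sum_j a j * x j 0.
  transitivity (\sum_j \sum_i a i * (M i j * x j 0)
      - `|nu| * \sum_j a j * x j 0).
    rewrite mulr_sumr -sumrB; apply: eq_bigr => j _.
    rewrite /gap mulrBl mulr_suml mulrA; congr (_ - _).
    by apply: eq_bigr => i _; rewrite mulrA.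
  rewrite exchange_big mulrBl; congr (_ - _).
  rewrite mulr_sumr; apply: eq_bigr => i _; rewrite -mulr_sumr mulrCA.
  by congr (_ * _); have /matrixP/(_ i 0) := Mx; rewrite !mxE.
have /matrix0Pn[i0 [k]] := un0; rewrite (ord1 i0) => uk {i0}.
have pairing0 : 0 < \sum_j a j * x j 0.
  rewrite (bigD1 k) //= ltr_wpDr ?mulr_gt0 ?normr_gt0 //.
  by apply: sumr_ge0 => j _; rewrite mulr_ge0 // (ltW (x0 j)).
have le_rho : `|nu| <= rho.
  rewrite -subr_ge0 -(pmulr_lge0 _ pairing0) -gapE.
  by apply: sumr_ge0 => j _; rewrite mulr_ge0 // ltW.
rewrite lt_neqAle le_rho andbT; apply: contra_neq nurho => nu_rho.
have gap_eq0 j : gap j = 0.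
  have := gapE; rewrite nu_rho subrr mul0r => /psumr_eq0P sum0.
  have /eqP := sum0 (fun i _ => mulr_ge0 (gap0 i) (ltW (x0 i))) j isT.
  by rewrite mulf_eq0 (gt_eqF (x0 j)) orbF => /eqP.
have [|t _ ut] := @normC_sum_eq C 'I_n xpredT (fun i => u 0 i * M i k).
  rewrite uME normrM (eq_bigr (fun i => a i * M i k)) //; apply/esym/eqP.
  by rewrite -subr_eq0; apply/eqP/gap_eq0.
have uE i : u 0 i = a i * t.
  have := ut i isT; rewrite nE mulrAC => /mulIf -> //.
  by rewrite gt_eqF.
apply: (mulIf uk); rewrite -uME -nu_rho [u 0 k]uE mulrA.
have /eqP := gap_eq0 k; rewrite subr_eq0 => /eqP <-; rewrite mulr_suml.
by apply: eq_bigr => i _; rewrite uE mulrAC.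
Qed.

Theorem corollary6 (R : realType) (n : nat) (e : rel 'I_n) (A : 'M[R]_n)
    (sigma : 'rV[R]_n) :
  is_tree e -> T_positive e A -> 0 < \det A -> signed_according e sigma ->
  (forall i j : 'I_n, 0 < (diag_mx sigma *m invmx A *m diag_mx sigma) i j) /\
  neumaier A sigma.
Proof.
move=> treeT TA detA sg.
set D := diag_mx sigma; set M := D *m invmx A *m D.
have uA : A \in unitmx by rewrite unitmxE unitfE gt_eqF.
have M0 i j : 0 < M i j.
  rewrite /M mul_mx_diag mul_diag_mx !mxE.
  exact: (signed_inverse_positive treeT TA detA sg).
have DD : D *m D = 1%:M.
  apply/matrixP=> i j; rewrite mul_diag_mx !mxE; case: eqP => [->|_].
    by rewrite !mulr1n; case: (sg.1 j) => ->; rewrite ?mulrNN mulr1.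
  by rewrite !mulr0n mulr0.
split=> //.
have [rho [x [rho0 x0 Mx]]] : exists rho (x : 'cV_n),
    [/\ 0 < rho, forall i, 0 < x i 0 & M *m x = rho *: x].
  have [n0 _ _ _ _] := treeT.
  case: n n0 => // m _ in e A sigma treeT TA detA sg D M uA M0 DD *.
  exact: perron_vector.
have rn0 : rho != 0 by rewrite gt_eqF.
have ADx : A *m (D *m x) = rho^-1 *: (D *m x).
  have DxE : D *m x = rho^-1 *: (invmx A *m (D *m x)).
    have := congr1 (mulmx D) Mx.
    rewrite /M -scalemxAr !mulmxA DD mul1mx => ->.
    by rewrite scalerA mulVf // scale1r.
  by rewrite {1}DxE -scalemxAr mulKVmx.
have n0 : (0 < n)%N by case: treeT.
have Dx i : 0 < sigma 0 i * (D *m x) i 0.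
  rewrite mul_diag_mx mxE mulrA; case: (sg.1 i) => ->.
    by rewrite !mul1r.
  by rewrite mulrNN !mul1r.
have Dxn0 : D *m x != 0.
  apply/eqP=> Dx0; have := Dx (Ordinal n0).
  by rewrite Dx0 mxE mulr0 ltxx.
exists rho^-1; split.
- exact: eigenvalue_col ADx.
- move=> mu /eigenvalueP[u uA_mu un0] mu_neq.
  pose f := real_complex R.
  have uAC : map_mx f A \in unitmx by rewrite map_unitmx.
  have mu0 : mu != 0.
    apply: contraNneq un0 => mu0; rewrite -(mulmxK uAC u) uA_mu mu0 scale0r.
    by rewrite mul0mx.
  have uB : u *m map_mx f (invmx A) = mu^-1 *: u.
    rewrite map_invmx -{2}(mulmxK uAC u) uA_mu -scalemxAl scalerA.
    by rewrite mulVf // scale1r.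
  have DDC : map_mx f D *m map_mx f D = 1%:M by rewrite -map_mxM DD map_mx1.
  (* The row vector u S is an eigenvector of M for 1 / mu. *)
  have lt_rho : `|mu^-1| < f rho.
    apply: (@perron_dominant _ _ (map_mx f M) (map_mx f x) (u *m map_mx f D)).
    - by move=> i j; rewrite mxE (ltcR 0).
    - by move=> i; rewrite mxE (ltcR 0).
    - by rewrite -map_mxM Mx map_mxZ.
    - apply: contraNneq un0 => uD0.
      by rewrite -[u]mulmx1 -DDC mulmxA uD0 mul0mx.
    - rewrite /M !map_mxM !mulmxA -(mulmxA u) DDC mulmx1 uB.
      by rewrite scalemxAl.
    - by apply: contraNneq mu_neq => nuE; rewrite -[mu]invrK nuE -fmorphV.
  have f0 : 0 < f rho by rewrite (ltcR 0).
  have -> : (rho^-1)%:C%C = (f rho)^-1 by rewrite fmorphV.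
  rewrite normfV (gtr0_norm f0) -ltf_pV2 ?posrE ?normr_gt0 ?invr_gt0 //.
  by rewrite invrK -normfV.
- by exists (D *m x).
Qed.
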